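(* Let $K$ be a commutative ring with $\frac12\in K$, let $n\ge1$, let $\delta$ be a skew $K$-derivation of $\Lambda_n(K)$, and for each $i=1,\ldots,n$ write $\delta(x_i)=u_i^{ev}+u_i^{od}$ with unique elements $u_i^{ev}\in\Lambda_n^{ev}$ and $u_i^{od}\in\Lambda_n^{od}$. Let $\delta=\delta^{ev}+\delta^{od}$ be the unique decomposition of $\delta$ into a sum of an even and an odd skew $K$-derivation. Then: 1. $\delta^{od}=\sum_{i=1}^n u_i^{ev}\partial_i$, and 2. $\delta^{ev}=\frac12\mathrm{sad}(a)$ where the unique element $a\in\Lambda_n'^{ev}$ is given by the formula $$a=\sum_{i=1}^{n-1}x_1\cdots x_i\,\partial_i\cdots\partial_1\partial_{i+1}(u_{i+1}^{od})+\partial_1(u_1^{od}).$$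
   Context: $\Lambda_n=\Lambda_n(K)=K\lfloor x_1,\ldots,x_n\rfloor$ is the Grassmann algebra: the $K$-algebra with generators $x_1,\ldots,x_n$ and defining relations $x_i^2=0$, $x_ix_j=-x_jx_i$ ($i\ne j$); it is a free $K$-module with basis $x^\alpha=x_1^{\alpha_1}\cdots x_n^{\alpha_n}$, $\alpha\in\{0,1\}^n$. Put $|\alpha|=\alpha_1+\cdots+\alpha_n$, $\Lambda_{n,i}=\bigoplus_{|\alpha|=i}Kx^\alpha$, $\Lambda_n^{ev}=\bigoplus_{i\text{ even}}\Lambda_{n,i}$, $\Lambda_n^{od}=\bigoplus_{i\text{ odd}}\Lambda_{n,i}$. A (left) skew $K$-derivation of $\Lambda_n$ is a $K$-linear map $\delta:\Lambda_n\to\Lambda_n$ such that $\delta(ab)=\delta(a)b+(-1)^s a\,\delta(b)$ for all parity-homogeneous $a,b$, where $s=0$ if $a\in\Lambda_n^{ev}$ and $s=1$ if $a\in\Lambda_n^{od}$. It is even if it preserves parity (maps $\Lambda_n^{ev}$ to $\Lambda_n^{ev}$ and $\Lambda_n^{od}$ to $\Lambda_n^{od}$) and odd if it reverses parity; every skew $K$-derivation is a unique sum of an even and an odd one. $\partial_i$ is the skew $K$-derivation with $\partial_i(x_j)=\delta_{ij}$. For $a\in\Lambda_n$, $\mathrm{sad}(a)$ is the $K$-linear map with $\mathrm{sad}(a)(b)=ab-(-1)^s ba$, where $s=0$ for $b\in\Lambda_n^{ev}$ and $s=1$ for $b\in\Lambda_n^{od}$. $\Lambda_n'^{ev}=\Lambda_n^{ev}$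 if $n$ is odd; if $n$ is even, $\Lambda_n'^{ev}$ is the $K$-submodule of $\Lambda_n^{ev}$ spanned by all even-degree monomials $x^\alpha$ other than $x_1\cdots x_n$. *)

(* Defs.v *)
From HB Require Import structures.
From mathcomp Require Import all_boot all_order all_algebra.

Set Implicit Arguments.
Unset Strict Implicit.
Unset Printing Implicit Defensive.

Import GRing.Theory.
Local Open Scope ring_scope.

(* An element of the Grassmann algebra is its family of coordinates on the   *)
(* basis x^alpha, with alpha in {0,1}^n encoded as its support S : {set 'I_n}; *)
(* the variables are x_0, ..., x_(n-1).                                      *)
Definition grassmann (K : comPzRingType) (n : nat) : Type :=
  {ffun {set 'I_n} -> K^o}.

Section Inversions.
Variable n : nat.
Implicit Types A B C : {set 'I_n}.

(* x^A x^B = (-1)^(gr_inv A B) x^(A :|: B) when A and B are disjoint. *)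
Definition gr_inv A B : nat := (\sum_(i in A) \sum_(j in B) (j < i)%N)%N.

Lemma gr_inv0s B : gr_inv set0 B = 0%N.
Proof. by rewrite /gr_inv big_set0. Qed.

Lemma gr_invs0 A : gr_inv A set0 = 0%N.
Proof. by rewrite /gr_inv big1 // => i _; rewrite big_set0. Qed.

Lemma gr_invUl A B C : [disjoint A & B] ->
  gr_inv (A :|: B) C = (gr_inv A C + gr_inv B C)%N.
Proof.
by move=> dAB; rewrite /gr_inv -bigU //; apply: eq_bigl => i; rewrite !inE.
Qed.

Lemma gr_invUr A B C : [disjoint B & C] ->
  gr_inv A (B :|: C) = (gr_inv A B + gr_inv A C)%N.
Proof.
move=> dBC; rewrite /gr_inv -big_split; by apply: eq_bigr => i _; rewrite -bigU //; apply: eq_bigl => j; rewrite !inE.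
Qed.

Lemma gr_setUDK A B : A \subset B -> A :|: (B :\: A) = B.
Proof.
move=> sAB; apply/setP=> i; rewrite !inE; case iA: (i \in A) => //=.
by rewrite (subsetP sAB).
Qed.

Lemma gr_setDUK A B : [disjoint B & A] -> (A :|: B) :\: A = B.
Proof. by rewrite setDUl setDv set0U => /setDidPl. Qed.

End Inversions.

Section Algebra.
Variables (K : comPzRingType) (n : nat).
Local Notation L := (grassmann K n).

HB.instance Definition _ := GRing.Lmodule.copy L {ffun {set 'I_n} -> K^o}.

Implicit Types (a b c : L) (S A B T : {set 'I_n}).

Definition gr_one : L := [ffun S => (S == set0)%:R].

Definition gr_mul a b : L :=
  [ffun S : {set 'I_n} => \sum_(A : {set 'I_n} | A \subset S)
     (-1) ^+ gr_inv A (S :\: A) * (a A * b (S :\: A))].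

Lemma gr_mulA : associative gr_mul.
Proof.
move=> a b c; apply/ffunP => S; rewrite !ffunE.
under eq_bigr => A sAS do rewrite ffunE !mulr_sumr.
under [RHS]eq_bigr => T sTS do rewrite ffunE mulr_suml mulr_sumr.
rewrite [RHS](exchange_big_dep (fun A => A \subset S)) /=; last first.
  by move=> T A sTS sAT; apply: subset_trans sAT sTS.
apply: eq_bigr => A sAS.
rewrite [RHS](reindex_onto (fun B => A :|: B) (fun T => T :\: A)) /=; last first.
  by move=> T /andP[_ sAT]; apply: gr_setUDK.
apply: eq_big => [B|B sB].
  rewrite subUset sAS subsetUl andbT /= setDUl setDv set0U subsetD.
  by congr (_ && _); apply/idP/eqP => [/setDidPl | /setDidPl].
have /andP[sBS dBA] : (B \subset S) && [disjoint B & A] by rewrite -subsetD.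
have -> : (A :|: B) :\: A = B by apply: gr_setDUK.
have -> : S :\: (A :|: B) = (S :\: A) :\: B by rewrite setDDl.
set C := _ :\: B.
have dBC : [disjoint B & C] by rewrite disjoint_sym disjoints_subset subsetDr.
have -> : S :\: A = B :|: C by rewrite /C gr_setUDK.
rewrite gr_invUr // gr_invUl; last by rewrite disjoint_sym.
rewrite !exprD !mulrA.
set s1 := _ ^+ gr_inv A B; set s2 := _ ^+ gr_inv A C; set s3 := _ ^+ _.
rewrite -!mulrA [a A * (s3 * _)]mulrCA [s3 * (s1 * _)]mulrCA.
by rewrite [s2 * (s1 * _)]mulrCA.
Qed.

Lemma gr_mul1 : left_id gr_one gr_mul.
Proof.
move=> a; apply/ffunP => S; rewrite ffunE (bigD1 set0) ?sub0set //= big1 => [|A].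
  by rewrite addr0 ffunE eqxx setD0 gr_inv0s expr0 !mul1r.
by case/andP=> _ /negPf nz; rewrite ffunE nz mul0r mulr0.
Qed.

Lemma gr_mulr1 : right_id gr_one gr_mul.
Proof.
move=> a; apply/ffunP => S; rewrite ffunE (bigD1 S) //= big1 => [|A].
  by rewrite addr0 ffunE setDv eqxx gr_invs0 expr0 mul1r mulr1.
case/andP=> sAS nAS; rewrite ffunE setD_eq0.
suff /negPf-> : ~~ (S \subset A) by rewrite !mulr0.
by apply: contra nAS => sSA; rewrite eqEsubset sAS.
Qed.

Lemma gr_mulDl : left_distributive gr_mul +%R.
Proof.
move=> a b c; apply/ffunP => S; rewrite !ffunE -big_split /=.
by apply: eq_bigr => A _; rewrite ffunE mulrDl mulrDr.
Qed.

Lemma gr_mulDr : right_distributive gr_mul +%R.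
Proof.
move=> a b c; apply/ffunP => S; rewrite !ffunE -big_split /=.
by apply: eq_bigr => A _; rewrite ffunE !mulrDr.
Qed.

HB.instance Definition _ := GRing.Zmodule_isPzRing.Build L
  gr_mulA gr_mul1 gr_mulr1 gr_mulDl gr_mulDr.

Lemma gr_mulE a b S : (a * b) S = \sum_(A : {set 'I_n} | A \subset S)
     (-1) ^+ gr_inv A (S :\: A) * (a A * b (S :\: A)).
Proof. by rewrite ffunE. Qed.

Lemma gr_1E S : (1 : L) S = (S == set0)%:R.
Proof. by rewrite ffunE. Qed.

Lemma gr_addE a b S : (a + b) S = a S + b S. Proof. by rewrite ffunE. Qed.
Lemma gr_oppE a S : (- a) S = - a S. Proof. by rewrite ffunE. Qed.
Lemma gr_0E S : (0 : L) S = 0. Proof. by rewrite ffunE. Qed.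
Lemma gr_scaleE k a S : (k *: a) S = k * a S. Proof. by rewrite ffunE. Qed.
Lemma gr_sumE I (r : seq I) (P : pred I) (F : I -> L) S :
  (\sum_(i <- r | P i) F i) S = \sum_(i <- r | P i) F i S.
Proof. exact: sum_ffunE. Qed.

(* The algebra structures of the library require 1 != 0, which fails here if *)
(* K = 0; hence these two laws instead of an instance.                       *)
Lemma gr_scaleAl k a b : k *: (a * b) = k *: a * b.
Proof.
apply/ffunP => S; rewrite gr_scaleE !gr_mulE mulr_sumr.
by apply: eq_bigr => A _; rewrite gr_scaleE mulrCA !mulrA.
Qed.

Lemma gr_scaleAr k a b : k *: (a * b) = a * (k *: b).
Proof.
apply/ffunP => S; rewrite gr_scaleE !gr_mulE mulr_sumr.
by apply: eq_bigr => A _; rewrite gr_scaleE mulrCA [a A * (k * _)]mulrCA.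
Qed.

Definition gr_gen (i : 'I_n) : L := [ffun S => (S == [set i])%:R].

(* The order of the factors is the increasing order of 'I_n. *)
Definition gr_monom S : L := \prod_(i < n | i \in S) gr_gen i.

(* gr_parity false and gr_parity true are the even and the odd part. *)
Definition gr_parity (s : bool) : {pred L} :=
  [pred a : L | [forall S : {set 'I_n}, (a S != 0) ==> (odd #|S| == s)]].

Lemma gr_parityP s a :
  reflect (forall S, odd #|S| != s -> a S = 0) (a \in gr_parity s).
Proof.
apply: (iffP forallP) => aP S.
  by move=> nS; apply/eqP; apply: contraNT nS; apply: (implyP (aP S)).
by apply/implyP; apply: contraNT => /aP->.
Qed.

Definition gr_proj (s : bool) a : L :=
  [ffun S : {set 'I_n} => if odd #|S| == s then a S else 0].

(* For even n the coefficient of the top monomial x_0 ... x_(n-1) vanishes. *)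
Definition gr_ev' : {pred L} :=
  [pred a : L | (a \in gr_parity false) && (odd n || (a setT == 0))].

Definition skew_derivation (d : {linear L -> L}) : Prop :=
  forall (s t : bool) a b, a \in gr_parity s -> b \in gr_parity t ->
    d (a * b) = d a * b + (-1) ^+ s * a * d b.

Definition preserves_parity (d : {linear L -> L}) : Prop :=
  forall s a, a \in gr_parity s -> d a \in gr_parity s.

Definition reverses_parity (d : {linear L -> L}) : Prop :=
  forall s a, a \in gr_parity s -> d a \in gr_parity (~~ s).

(* Left skew partial derivative: x_i is first moved to the front of the      *)
(* monomial, past the variables of smaller index. See gr_partialP below.     *)
Definition gr_partial (i : 'I_n) a : L :=
  [ffun S : {set 'I_n} => if i \in S then 0
    else (-1) ^+ #|[set j in S | (j < i)%N]| * a (i |: S)].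

Fact gr_partial_is_linear i : linear (gr_partial i).
Proof.
move=> k a b; apply/ffunP => S; rewrite gr_addE gr_scaleE.
rewrite [LHS]ffunE [gr_partial i a S]ffunE [gr_partial i b S]ffunE.
case: ifP => _; first by rewrite mulr0 addr0.
by rewrite gr_addE gr_scaleE mulrDr mulrCA.
Qed.
HB.instance Definition _ i :=
  GRing.isLinear.Build K L L *:%R (gr_partial i) (gr_partial_is_linear i).

(* gr_partials [:: i_1; ...; i_k] b = d_(i_k) (... (d_(i_1) b)) *)
Definition gr_partials (r : seq 'I_n) b : L :=
  foldl (fun c j => gr_partial j c) b r.

(* a b - (-1)^s b a for b of parity s, extended by linearity to all b. *)
Definition sad a b : L :=
  a * b - (gr_proj false b * a - gr_proj true b * a).

End Algebra.

Arguments gr_parity {K n} s.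
Arguments gr_ev' {K n}.
Arguments gr_gen {K n} i.
Arguments gr_monom {K n} S.
Arguments gr_partial {K n} i a.
Arguments gr_partials {K n} r b.

Ltac gr_odd_cases :=
  repeat match goal with |- context [odd ?x] => case: (odd x) end; done.

Section Theory.
Variables (K : comPzRingType) (n : nat).
Local Notation L := (grassmann K n).
Implicit Types (a b c : L) (S A B T : {set 'I_n}) (i j : 'I_n) (s t : bool).

Fact gr_proj_is_linear s : linear (@gr_proj K n s).
Proof.
move=> k a b; apply/ffunP => S; rewrite gr_addE gr_scaleE.
rewrite [LHS]ffunE [gr_proj s a S]ffunE [gr_proj s b S]ffunE.
by case: ifP => _; rewrite ?mulr0 ?addr0 // gr_addE gr_scaleE.
Qed.
HB.instance Definition _ s :=
  GRing.isLinear.Build K L L *:%R (@gr_proj K n s) (gr_proj_is_linear s).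

Lemma gr_proj_parity s a : gr_proj s a \in gr_parity s.
Proof. by apply/gr_parityP => S /negPf nS; rewrite ffunE nS. Qed.

Lemma gr_proj_id s a : a \in gr_parity s -> gr_proj s a = a.
Proof.
by move/gr_parityP=> aP; apply/ffunP=> S; rewrite ffunE; case: eqP => // /eqP/aP.
Qed.

Lemma gr_proj_eq0 s t a : a \in gr_parity s -> t != s -> gr_proj t a = 0.
Proof.
move=> /gr_parityP aP nts; apply/ffunP=> S; rewrite ffunE gr_0E.
by case: eqP => // oS; apply: aP; rewrite oS.
Qed.

Lemma gr_projD a : a = gr_proj false a + gr_proj true a.
Proof.
apply/ffunP=> S; rewrite gr_addE !ffunE.
by case: (odd _); rewrite /= ?addr0 ?add0r.
Qed.

Lemma sadE s a b : b \in gr_parity s ->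
  sad a b = a * b - (-1) ^+ s * b * a.
Proof.
move=> bP; rewrite /sad; case: s bP => bP.
  by rewrite (gr_proj_id bP) (gr_proj_eq0 bP) // mul0r sub0r mulN1r mulNr.
by rewrite (gr_proj_id bP) (gr_proj_eq0 bP) // mul0r subr0 mul1r.
Qed.

Fact sad_is_linear a : linear (sad a).
Proof.
move=> k b c; rewrite /sad !linearP mulrDr -gr_scaleAr !mulrDl -!gr_scaleAl.
rewrite !scalerBr [RHS]addrACA -opprD; congr (_ - _).
by rewrite [RHS]addrACA -opprD.
Qed.
HB.instance Definition _ a :=
  GRing.isLinear.Build K L L *:%R (sad a) (sad_is_linear a).

Lemma gr_parity1 : (1 : L) \in gr_parity false.
Proof.
apply/gr_parityP=> S oS; rewrite gr_1E.
by case: (S =P set0) oS => [->|//]; rewrite cards0.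
Qed.

Lemma gr_gen_parity i : (gr_gen i : L) \in gr_parity true.
Proof.
apply/gr_parityP=> S oS; rewrite ffunE.
by case: (S =P [set i]) oS => [->|//]; rewrite cards1.
Qed.

Lemma gr_genM i a S : (gr_gen i * a) S =
  if i \in S then (-1) ^+ gr_inv [set i] (S :\ i) * a (S :\ i) else 0.
Proof.
rewrite gr_mulE; case: ifP => iS.
  rewrite (bigD1 [set i]) ?sub1set //= big1 ?addr0 => [|A /andP[_ /negPf nA]].
    by rewrite ffunE eqxx mul1r.
  by rewrite ffunE nA mul0r mulr0.
rewrite big1 // => A sAS; rewrite ffunE; case: eqP sAS => [->|_ _].
  by rewrite sub1set iS.
by rewrite mul0r mulr0.
Qed.

Lemma gr_gen_sqr i : gr_gen i * gr_gen i = 0 :> L.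
Proof.
apply/ffunP=> S; rewrite gr_genM gr_0E; case: ifP => // _.
rewrite ffunE; case: eqP => [/setP/(_ i)|]; rewrite ?mulr0 //.
by rewrite !inE eqxx.
Qed.

Lemma gr_inv1 i j : gr_inv [set i] [set j] = (j < i)%N.
Proof. by rewrite /gr_inv !big_set1. Qed.

Lemma gr_gen_anti i j : i != j ->
  gr_gen i * gr_gen j = - (gr_gen j * gr_gen i) :> L.
Proof.
have key k l S : k != l ->
  ((gr_gen k : L) * gr_gen l) S = (-1) ^+ (l < k)%N * (S == [set k; l])%:R.
  move=> nkl; rewrite gr_genM; case: ifP => kS.
    rewrite ffunE; have -> : (S :\ k == [set l]) = (S == [set k; l]).
      apply/eqP/eqP => [<-|->]; first by rewrite setD1K.
      by rewrite setU1K // inE.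
    case: eqP => [->|]; last by rewrite !mulr0.
    by rewrite setU1K ?inE // gr_inv1.
  case: eqP kS => [->|]; last by rewrite mulr0.
  by rewrite !inE eqxx.
move=> nij; apply/ffunP=> S; have nji : j != i by rewrite eq_sym.
rewrite gr_oppE !key //.
rewrite [[set j; i]]setUC -mulNr; congr (_ * _).
case: (ltngtP i j) => [_|_|/val_inj eij]; rewrite ?expr0 ?expr1 ?opprK //.
by rewrite eij eqxx in nij.
Qed.

Lemma gr_prod_gen (r : seq 'I_n) : sorted ltn (map val r) ->
  \prod_(i <- r) gr_gen i = [ffun S => (S == [set:: r])%:R] :> L.
Proof.
elim: r => [_|i r IHr] /=.
  by rewrite big_nil; apply/ffunP=> S; rewrite gr_1E.
move=> ir; rewrite big_cons IHr; last exact: path_sorted ir.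
have ltir : {in r, forall j, (i < j)%N}.
  move=> j jr; have /allP := order_path_min ltn_trans ir; apply.
  exact: map_f.
have ni : i \notin [set:: r] by rewrite inE; apply/negP=> /ltir; rewrite ltnn.
have -> : [set:: i :: r] = i |: [set:: r].
  by apply/setP=> x; rewrite !inE.
apply/ffunP=> S; rewrite gr_genM !ffunE.
case: ifP => iS; last by case: eqP iS => // ->; rewrite setU11.
have -> : (S :\ i == [set:: r]) = (S == i |: [set:: r]).
  by apply/eqP/eqP => [<-|->]; rewrite ?setD1K ?setU1K.
case: eqP => [->|]; last by rewrite mulr0.
rewrite setU1K // /gr_inv big_set1 big1 ?mul1r // => j.
by rewrite inE => /ltir lij; rewrite ltnNge ltnW.
Qed.

Lemma gr_monomE S T : (gr_monom S : L) T = (T == S)%:R.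
Proof.
rewrite /gr_monom -big_filter gr_prod_gen.
  rewrite ffunE; congr (_ == _)%:R; apply/setP=> i.
  by rewrite inE mem_filter mem_index_enum andbT.
have : sorted ltn (map val (index_enum 'I_n)).
  by rewrite [index_enum _]unlock -enumT val_enum_ord iota_ltn_sorted.
rewrite !sorted_map; apply: sorted_filter => x y z; exact: ltn_trans.
Qed.

(* The monomials form a basis: a uniquely determines its coordinates a S. *)
Lemma gr_monom_coord (c : {set 'I_n} -> K) T :
  ((\sum_S c S *: gr_monom S) : L) T = c T.
Proof.
rewrite gr_sumE (bigD1 T) //= big1 => [|S nST]; rewrite gr_scaleE gr_monomE.
  by rewrite eqxx mulr1 addr0.
by rewrite eq_sym (negPf nST) mulr0.
Qed.

Lemma gr_monom_sum a : a = \sum_S a S *: gr_monom S.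
Proof. by apply/ffunP=> T; rewrite gr_monom_coord. Qed.

Lemma gr_lt_inv i A : #|[set j in A | (j < i)%N]| = gr_inv [set i] A.
Proof.
rewrite /gr_inv big_set1 -sum1_card big_mkcond [RHS]big_mkcond /=.
by apply: eq_bigr => j _; rewrite inE; case: (j \in A); case: ltnP.
Qed.

Lemma gr_invC1 i A : i \notin A ->
  (gr_inv [set i] A + gr_inv A [set i] = #|A|)%N.
Proof.
move=> iA; rewrite {1}/gr_inv big_set1 -big_split -sum1_card /=.
apply: eq_bigr => j jA; rewrite big_set1.
case: ltngtP => // /val_inj ji; by rewrite -ji jA in iA.
Qed.

Lemma gr_partialE i a S : gr_partial i a S =
  if i \in S then 0 else (-1) ^+ gr_inv [set i] S * a (i |: S).
Proof. by rewrite ffunE gr_lt_inv. Qed.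

Lemma gr_partial_gen i j : gr_partial i (gr_gen j) = (i == j)%:R :> L.
Proof.
apply/ffunP=> S; rewrite gr_partialE ffunE.
have -> : ((i == j)%:R : L) S = ((i == j) && (S == set0))%:R.
  by case: eqP => _; rewrite ?gr_1E ?gr_0E.
case: ifP => iS.
  case: (S =P set0) iS => [->|_ _]; first by rewrite inE.
  by rewrite andbF.
have [eij|nij] := eqVneq i j; last first.
  case: eqP => [/setP/(_ i)|]; last by rewrite mulr0.
  by rewrite !inE eqxx (negPf nij).
have [->|nS] := eqVneq S set0.
  by rewrite setU0 eij eqxx gr_invs0 mul1r.
case: eqP => [eS|]; last by rewrite mulr0.
case/set0Pn: nS => k kS; have := setU1r j kS; rewrite -eij eS inE -eij.
by move=> /eqP ek; rewrite -ek kS in iS.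
Qed.

Lemma gr_sgn_eq (R : pzRingType) (p q : nat) :
  odd p = odd q -> (-1) ^+ p = (-1) ^+ q :> R.
Proof. by move=> opq; rewrite -signr_odd opq signr_odd. Qed.

Lemma gr_sgn_neq (R : pzRingType) (p q : nat) :
  odd p = ~~ odd q -> (-1) ^+ p = - (-1) ^+ q :> R.
Proof. by move=> opq; rewrite -signr_odd opq signrN signr_odd. Qed.

Lemma gr_sgnl p q (x y : K) :
  (-1) ^+ p * ((-1) ^+ q * x * y) = (-1) ^+ (p + q) * (x * y).
Proof. by rewrite exprD !mulrA. Qed.

Lemma gr_sgnr p q (x y : K) :
  (-1) ^+ p * (x * ((-1) ^+ q * y)) = (-1) ^+ (p + q) * (x * y).
Proof. by rewrite exprD -mulrA; congr (_ * _); rewrite mulrCA. Qed.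

Lemma gr_partialM i a b : gr_partial i (a * b) =
  gr_partial i a * b + (gr_proj false a - gr_proj true a) * gr_partial i b.
Proof.
pose sg A := gr_proj false a A - gr_proj true a A.
have sgE A : sg A = (-1) ^+ #|A| * a A.
  rewrite /sg !ffunE -signr_odd; case: (odd _).
    by rewrite sub0r mulN1r.
  by rewrite subr0 mul1r.
apply/ffunP=> S; rewrite gr_partialE gr_addE !gr_mulE.
have -> : \sum_(A : {set 'I_n} | A \subset S) (-1) ^+ gr_inv A (S :\: A) *
    ((gr_proj false a - gr_proj true a) A * gr_partial i b (S :\: A)) =
  \sum_(A : {set 'I_n} | A \subset S) (-1) ^+ (gr_inv A (S :\: A) + #|A|) *
    (a A * gr_partial i b (S :\: A)).
  apply: eq_bigr => A _; rewrite gr_addE gr_oppE -/(sg A) sgE exprD.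
  by rewrite !mulrA.
case: ifP => iS.
  rewrite (bigID (fun A : {set 'I_n} => i \in A)) /= big1 ?add0r; last first.
    by move=> A /andP[_ iA]; rewrite gr_partialE iA mul0r mulr0.
  rewrite [X in _ + X](bigID (fun A : {set 'I_n} => i \in A)) /=.
  rewrite [X in _ + (_ + X)]big1 ?addr0; last first.
    move=> A /andP[_ iA]; rewrite gr_partialE !inE iS iA /=.
    by rewrite mulr0 mulr0.
  rewrite [X in _ + X](reindex_onto (fun A => i |: A) (fun A => A :\ i)) /=;
    last by move=> A /andP[_ iA]; rewrite setD1K.
  apply/esym/eqP; rewrite addr_eq0 -sumrN; apply/eqP.
  have dP A : (i |: A \subset S) && (i \in i |: A) && ((i |: A) :\ i == A)
            = (A \subset S) && (i \notin A).
    rewrite subUset sub1set iS setU11 andbT /=; congr (_ && _).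
    by apply/eqP/idP => [<-|/setU1K//]; rewrite !inE eqxx.
  apply: eq_big => [A|A /andP[sAS iA]]; first by rewrite dP.
  set B := S :\: (i |: A).
  have iB : i \notin B by rewrite !inE eqxx.
  have eB : S :\: A = i |: B.
    apply/setP=> j; rewrite !inE; case: (j =P i) => [->|_] //=.
    by rewrite iS iA.
  rewrite eB gr_partialE (negPf iA) [gr_partial i b B]gr_partialE (negPf iB).
  have dA : [disjoint [set i] & A] by rewrite disjoints1.
  have dB : [disjoint [set i] & B] by rewrite disjoints1.
  rewrite gr_invUr // gr_invUl // cardsU1 iA -(gr_invC1 iA).
  rewrite gr_sgnl gr_sgnr -mulNr.
  congr (_ * _); apply: gr_sgn_neq.
  rewrite /= !oddD /=.
  gr_odd_cases.
rewrite mulr_sumr (bigID (fun A : {set 'I_n} => i \in A)) /=.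
congr (_ + _).
  rewrite (reindex_onto (fun A => i |: A) (fun A => A :\ i)) /=;
    last by move=> A /andP[_ iA]; rewrite setD1K.
  apply: eq_big => [A|A].
    have [iA|iA] := boolP (i \in A).
      rewrite (_ : _ == _ = false) ?andbF; last first.
        by apply/eqP=> /setP/(_ i); rewrite !inE eqxx iA.
      by apply/esym/negbTE/negP => /subsetP/(_ i iA); rewrite iS.
    rewrite setU11 setU1K // eqxx !andbT; apply/idP/idP.
      move=> sA; apply/subsetP=> j jA.
      have := subsetP sA j; rewrite !inE jA orbT => /(_ isT).
      by case: eqP jA iA => // -> ->.
    exact: setUS.
  move=> /andP[/andP[sA _] /eqP eA].
  have iA : i \notin A by rewrite -eA !inE eqxx.
  have eB : (i |: S) :\: (i |: A) = S :\: A.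
    apply/setP=> j; rewrite !inE; case: (j =P i) => [->|_] //=.
    by rewrite iS andbF.
  have sAS : A \subset S.
    by rewrite -eA; apply: subset_trans (setSD _ sA) _; rewrite setU1K // iS.
  rewrite eB gr_partialE (negPf iA).
  have dA : [disjoint [set i] & A] by rewrite disjoints1.
  rewrite gr_invUl // -[in X in (-1) ^+ X * (_ * _)](gr_setUDK sAS).
  rewrite gr_invUr; last by rewrite disjoint_sym disjoints_subset subsetDr.
  rewrite gr_sgnl [LHS]mulrA -exprD; congr (_ * _).
  apply: gr_sgn_eq; rewrite !oddD; gr_odd_cases.
apply: eq_big => [A|A /andP[sA iA]].
  apply/andP/idP => [[sA iA]|sA].
    apply/subsetP=> j jA; have := subsetP sA j jA.
    by rewrite !inE; case: eqP jA iA => // -> ->.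
  split; first by apply: subset_trans sA (subsetUr _ _).
  by apply: contraFN iS => /(subsetP sA).
have sAS : A \subset S.
  apply/subsetP=> j jA; have := subsetP sA j jA.
  by rewrite !inE; case: eqP jA iA => // -> ->.
have eB : (i |: S) :\: A = i |: (S :\: A).
  apply/setP=> j; rewrite !inE; case: (j =P i) => [->|_] //=.
  by rewrite iA.
have iB : i \notin S :\: A by rewrite !inE iS andbF.
rewrite eB gr_partialE (negPf iB).
have dB : [disjoint [set i] & S :\: A] by rewrite disjoints1.
rewrite gr_invUr // -(gr_invC1 iA) -[in X in (-1) ^+ X * (_ * _)](gr_setUDK sAS).
rewrite gr_invUr; last by rewrite disjoint_sym disjoints_subset subsetDr.
rewrite gr_sgnr [LHS]mulrA -exprD; congr (_ * _).
apply: gr_sgn_eq; rewrite !oddD; gr_odd_cases.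
Qed.

Lemma gr_parityM s t a b :
  a \in gr_parity s -> b \in gr_parity t -> a * b \in gr_parity (s (+) t).
Proof.
move=> /gr_parityP aP /gr_parityP bP; apply/gr_parityP => S oS.
rewrite gr_mulE big1 // => A sAS.
have [oA|/aP->] := eqVneq (odd #|A|) s; last by rewrite mul0r mulr0.
rewrite bP ?mulr0 //; apply: contra oS => /eqP <-.
by rewrite -oA -(cardsID A S) (setIidPr sAS) oddD.
Qed.

Lemma gr_partial_skew i : skew_derivation (gr_partial i : {linear L -> L}).
Proof.
move=> s t a b aP bP /=; rewrite gr_partialM; congr (_ + _).
case: s aP => aP; rewrite (gr_proj_id aP) (gr_proj_eq0 aP) //.
  by rewrite sub0r mulN1r.
by rewrite subr0 mul1r.
Qed.

Lemma skew_ext (d d' : {linear L -> L}) :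
    skew_derivation d -> skew_derivation d' ->
  (forall i, d (gr_gen i) = d' (gr_gen i)) -> d =1 d'.
Proof.
move=> dS d'S dd' a; rewrite [a]gr_monom_sum !linear_sum /=.
apply: eq_bigr => S _; rewrite !linearZ /=; congr (_ *: _).
have one0 (f : {linear L -> L}) : skew_derivation f -> f 1 = 0.
  move=> /(_ _ _ _ _ gr_parity1 gr_parity1).
  by rewrite expr0 !mul1r mulr1 -[LHS]addr0 => /addrI <-.
rewrite /gr_monom -big_filter; set r := filter _ _.
suff [] : \prod_(i <- r) gr_gen i \in @gr_parity K n (odd (size r)) /\
  d (\prod_(i <- r) gr_gen i) = d' (\prod_(i <- r) gr_gen i) by [].
elim: r => [|i r [rP rE]].
  by rewrite big_nil !one0 //; split=> //; apply: gr_parity1.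
rewrite big_cons; split; first exact: gr_parityM (gr_gen_parity i) rP.
by rewrite (dS _ _ _ _ (gr_gen_parity i) rP) (d'S _ _ _ _ (gr_gen_parity i) rP) dd' rE.
Qed.

(* gr_partial i is the unique skew derivation sending x_j to delta_ij. *)
Lemma gr_partialP i (d : {linear L -> L}) :
  skew_derivation d /\ (forall j, d (gr_gen j) = (i == j)%:R) <->
  d =1 gr_partial i.
Proof.
split=> [[dS dE]|dE].
  apply: (@skew_ext d (gr_partial i : {linear L -> L})) => //.
    exact: gr_partial_skew.
  by move=> j; rewrite dE /= gr_partial_gen.
split=> [s t a b aP bP|j]; last by rewrite dE gr_partial_gen.
by rewrite !dE; apply: gr_partial_skew bP.
Qed.

Lemma gr_projC s a : a = gr_proj s a + gr_proj (~~ s) a.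
Proof. by case: s; rewrite {1}[a]gr_projD //= addrC. Qed.

Lemma gr_projMr p u a b : b \in gr_parity u ->
  gr_proj p (a * b) = gr_proj (p (+) u) a * b.
Proof.
move=> bP; have abP q : gr_proj q a * b \in gr_parity (q (+) u).
  exact: gr_parityM (gr_proj_parity _ _) bP.
have := abP (p (+) u); have := abP (~~ (p (+) u)).
rewrite addNb addbK => abN ab; rewrite {1}[a](gr_projC (p (+) u)) mulrDl.
rewrite linearD /= (gr_proj_id ab) (gr_proj_eq0 abN) ?addr0 //.
by case: (p).
Qed.

Lemma gr_projMl p u a b : a \in gr_parity u ->
  gr_proj p (a * b) = a * gr_proj (p (+) u) b.
Proof.
move=> aP; have abP q : a * gr_proj q b \in gr_parity (q (+) u).
  by rewrite addbC; apply: gr_parityM aP (gr_proj_parity _ _).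
have := abP (p (+) u); have := abP (~~ (p (+) u)).
rewrite addNb addbK => abN ab; rewrite {1}[b](gr_projC (p (+) u)) mulrDr.
rewrite linearD /= (gr_proj_id ab) (gr_proj_eq0 abN) ?addr0 //.
by case: (p).
Qed.

(* The even (s = false) and odd (s = true) components of a linear map. *)
Definition gr_component (d : {linear L -> L}) s a : L :=
  gr_proj s (d (gr_proj false a)) + gr_proj (~~ s) (d (gr_proj true a)).

Fact gr_component_is_linear d s : linear (gr_component d s).
Proof.
by move=> k a b; rewrite /gr_component !linearP /= scalerDr addrACA.
Qed.
HB.instance Definition _ d s := GRing.isLinear.Build K L L *:%R
  (gr_component d s) (gr_component_is_linear d s).

Lemma gr_componentE d s t a : a \in gr_parity t ->
  gr_component d s a = gr_proj (t (+) s) (d a).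
Proof.
move=> aP; rewrite /gr_component; case: t aP => aP;
  by rewrite (gr_proj_id aP) (gr_proj_eq0 aP) // !linear0 ?addr0 ?add0r.
Qed.

Lemma gr_component_skew (d : {linear L -> L}) s : skew_derivation d ->
  skew_derivation (gr_component d s : {linear L -> L}).
Proof.
move=> dS t u a b aP bP /=.
rewrite (gr_componentE _ _ aP) (gr_componentE _ _ bP).
rewrite (gr_componentE _ _ (gr_parityM aP bP)) (dS _ _ _ _ aP bP) linearD /=.
rewrite (gr_projMr _ _ bP) -!mulrA.
have -> (x : L) : (-1) ^+ t * x = (-1) ^+ t *: x.
  by case: t {aP}; rewrite ?expr1 ?mulN1r ?scaleN1r // !expr0 mul1r scale1r.
have -> (x : L) : (-1) ^+ t * x = (-1) ^+ t *: x.
  by case: t {aP}; rewrite ?expr1 ?mulN1r ?scaleN1r // !expr0 mul1r scale1r.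
rewrite linearZ /= (gr_projMl _ _ aP).
by congr (gr_proj _ _ * _ + _ *: (_ * gr_proj _ _)); case: (t) (u) (s) => [] [] [].
Qed.

Lemma skew_decomposition (d : {linear L -> L}) : skew_derivation d ->
  exists d_ev d_od : {linear L -> L},
    [/\ skew_derivation d_ev, skew_derivation d_od, preserves_parity d_ev,
        reverses_parity d_od & forall b, d b = d_ev b + d_od b].
Proof.
move=> dS; exists (gr_component d false), (gr_component d true).
split; try exact: gr_component_skew.
- by move=> s a aP; rewrite /= (gr_componentE _ _ aP) addbF gr_proj_parity.
- by move=> s a aP; rewrite /= (gr_componentE _ _ aP) addbT gr_proj_parity.
move=> b; rewrite /= /gr_component addrACA [X in _ + X]addrC -!gr_projD.
by rewrite -linearD -gr_projD.
Qed.

Lemma skew_decomposition_unique (d d_ev d_od : {linear L -> L}) :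
    preserves_parity d_ev -> reverses_parity d_od ->
    (forall b, d b = d_ev b + d_od b) ->
  d_ev =1 gr_component d false /\ d_od =1 gr_component d true.
Proof.
move=> evP odP dE.
have pf (b : L) := gr_proj_parity false b; have pt (b : L) := gr_proj_parity true b.
split=> b; rewrite /gr_component {1}[b]gr_projD !dE !linearD /=.
  rewrite (gr_proj_id (evP _ _ (pf b))) (gr_proj_eq0 (odP _ _ (pf b))) //.
  by rewrite (gr_proj_id (evP _ _ (pt b))) (gr_proj_eq0 (odP _ _ (pt b))) // !addr0.
rewrite (gr_proj_eq0 (evP _ _ (pf b))) // (gr_proj_id (odP _ _ (pf b))).
by rewrite (gr_proj_eq0 (evP _ _ (pt b))) // (gr_proj_id (odP _ _ (pt b))) !add0r.
Qed.

End Theory.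

(* Main.v *)
(* The even part of delta sends x_i to u_i^od, and for a even (1/2)sad(a) sends
   x_i to x_i a, so one has to solve x_i a = u_i^od for all i.  Applying delta
   to the defining relations gives x_j u_i^od = - x_i u_j^od, whence
   u_i^od = x_i w_i with w_i = d_i(u_i^od), and w_i and w_j agree on every
   monomial avoiding both x_i and x_j.  Hence a solution must have, on each
   monomial x^S other than the top one, the coefficient of any w_i with i not
   in S.  The operator x_1...x_i d_i...d_1 projects onto the monomials divisible
   by x_1...x_i, so the stated formula selects the smallest such i. *)
Require Import Defs.
From HB Require Import structures.
From mathcomp Require Import all_boot all_order all_algebra.

Set Implicit Arguments.
Unset Strict Implicit.
Unset Printing Implicit Defensive.

Import GRing.Theory.
Local Open Scope ring_scope.

Section Grassmann.
Variables (K : comPzRingType) (n : nat).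
Local Notation L := (grassmann K n).
Implicit Types (a b c : L) (A B S : {set 'I_n}) (i j : 'I_n).

(** * Graded commutativity *)

(** Each pair in [A] x [B] is an inversion in exactly one of the two orders, since disjointness
    excludes equal entries. *)
Lemma gr_invC A B : [disjoint A & B] ->
  (gr_inv A B + gr_inv B A = #|A| * #|B|)%N.
Proof.
move=> dAB; rewrite /gr_inv [X in (_ + X)%N]exchange_big -big_split /=.
rewrite -sum_nat_const; apply: eq_bigr => i iA.
rewrite -big_split -sum1_card; apply: eq_bigr => j jB /=.
case: ltngtP => // /val_inj eji.
by rewrite -eji (disjointFl dAB jB) in iA.
Qed.

(** Complementation in [S] matches the terms of the two products; by [gr_invC] their signs differ by
    the parity of the product of the degrees. *)
Lemma gr_supercomm (s t : bool) a b :
    a \in gr_parity s -> b \in gr_parity t ->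
  a * b = (-1) ^+ (s && t) * (b * a).
Proof.
move=> /gr_parityP aP /gr_parityP bP.
have -> : (-1) ^+ (s && t) * (b * a) = ((-1) ^+ (s && t) : K) *: (b * a).
  by case: (s && t); rewrite ?expr1 ?mulN1r ?scaleN1r // !expr0 mul1r scale1r.
apply/ffunP=> S; rewrite gr_scaleE !gr_mulE mulr_sumr.
rewrite [RHS](reindex_onto (fun A => S :\: A) (fun A => S :\: A)) /=; last first.
  by move=> A sAS; rewrite setDDr setDv set0U (setIidPr sAS).
apply: eq_big => [A|A sAS].
  rewrite subsetDl setDDr setDv set0U; apply/idP/eqP => [/setIidPr//|<-].
  exact: subsetIl.
rewrite setDDr setDv set0U (setIidPr sAS).
have [oA|/aP->] := eqVneq (odd #|A|) s; last by rewrite !(mul0r, mulr0).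
have [oB|/bP->] := eqVneq (odd #|S :\: A|) t; last by rewrite !(mul0r, mulr0).
rewrite [RHS]mulrA -exprD [b _ * _]mulrC; congr (_ * _); apply: gr_sgn_eq.
have dA : [disjoint A & S :\: A].
  by rewrite disjoint_sym disjoints_subset subsetDr.
rewrite oddD oddb -oA -oB -oddM -(gr_invC dA) oddD.
by rewrite -addbA addbb addbF.
Qed.

Lemma gr_even_comm a b : a \in gr_parity false -> a * b = b * a.
Proof.
move=> aP; rewrite [b]gr_projD mulrDr mulrDl.
by rewrite !(gr_supercomm aP (gr_proj_parity _ b)) !mul1r.
Qed.

(** * Multiplying and differentiating by generators *)

Lemma gr_genMU i a S : i \notin S ->
  (gr_gen i * a) (i |: S) = (-1) ^+ gr_inv [set i] S * a S.
Proof. by move=> iS; rewrite gr_genM setU11 setU1K. Qed.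

(** Multiplication by x_i only moves the coordinate at [S] to [i |: S], up to a sign that can be
    cancelled. *)
Lemma gr_genM_coordI i a b S : i \notin S ->
  gr_gen i * a = gr_gen i * b -> a S = b S.
Proof.
move=> iS /(congr1 (fun c : L => c (i |: S))); rewrite !gr_genMU //.
by move/(congr1 ( *%R ((-1) ^+ gr_inv [set i] S))); rewrite !signrMK.
Qed.

Lemma gr_partial_parity i s a : a \in gr_parity s ->
  gr_partial i a \in gr_parity (~~ s).
Proof.
move=> /gr_parityP aP; apply/gr_parityP=> S oS; rewrite gr_partialE.
case: ifPn => // iS; rewrite aP ?mulr0 // cardsU1 iS oddD /=.
by case: (odd _) s oS {aP} => [] [].
Qed.

(** Apply [gr_partial i] to x_i a = 0: the skew Leibniz rule leaves a - x_i d_i(a) = 0. *)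
Lemma gr_gen_partial i a : a \in gr_parity true -> gr_gen i * a = 0 ->
  a = gr_gen i * gr_partial i a.
Proof.
move=> aP /(congr1 (gr_partial i)).
rewrite linear0 /= (gr_partial_skew i (gr_gen_parity K i) aP) /=.
rewrite gr_partial_gen eqxx mul1r expr1 mulN1r mulNr => /eqP.
by rewrite subr_eq0 => /eqP.
Qed.

(** The head of [r] is differentiated first and multiplied back last, so the operations nest; each
    x_i returns with the sign it left with. *)
Lemma gr_prod_partials (r : seq 'I_n) a S : uniq r ->
  ((\prod_(i <- r) gr_gen i) * gr_partials r a) S =
  if all (mem S) r then a S else 0.
Proof.
elim: r a S => [|i r IHr] a S /=; first by rewrite big_nil mul1r.
case/andP=> ir ur; rewrite big_cons -mulrA gr_genM.
case: ifP => iS; rewrite ?iS //= IHr //.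
have -> : all (mem (S :\ i)) r = all (mem S) r.
  apply: eq_in_all => j jr; rewrite /= !inE.
  by case: eqP => // eji; rewrite -eji jr in ir.
case: ifP => _; last by rewrite mulr0.
by rewrite gr_partialE setD11 setD1K // signrMK.
Qed.

(** * Skew derivations of the two required shapes *)

(** In the Leibniz expansion the two mixed terms in b a c cancel. *)
Lemma sad_skew a : skew_derivation (sad a : {linear L -> L}).
Proof.
move=> s t b c bP cP /=.
rewrite (sadE a (gr_parityM bP cP)) (sadE a bP) (sadE a cP) signr_addb.
rewrite mulrBl mulrBr !mulrA.
have sgC (x : L) : x * (-1) ^+ t = (-1) ^+ t * x.
  exact: commr_sign.
rewrite -[(-1) ^+ s * b * (-1) ^+ t]mulrA [b * _]sgC !mulrA.
by rewrite addrA subrK.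
Qed.

(** An even [a] is central and x_i is odd, so sad(a)(x_i) = 2 x_i a. *)
Lemma half_sad_gen (half : K) i a : 2%:R * half = 1 -> a \in gr_parity false ->
  half *: sad a (gr_gen i) = gr_gen i * a.
Proof.
move=> half2 aP; rewrite (sadE a (gr_gen_parity K i)) expr1 mulN1r mulNr opprK.
by rewrite (gr_even_comm _ aP) -mulr2n -scaler_nat scalerA mulrC half2 scale1r.
Qed.

Lemma sadZ k a b : sad (k *: a) b = k *: sad a b.
Proof. by rewrite /sad -!gr_scaleAl -!gr_scaleAr !scalerBr. Qed.

Section Combination.
Variable u : 'I_n -> L.

(** Named so that it can carry the linear structure that [skew_ext] expects. *)
Definition gr_partial_comb b : L := \sum_i u i * gr_partial i b.

Fact gr_partial_comb_is_linear : linear gr_partial_comb.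
Proof.
move=> k a b; rewrite /gr_partial_comb scaler_sumr -big_split.
by apply: eq_bigr => i _; rewrite linearP /= mulrDr gr_scaleAr.
Qed.
HB.instance Definition _ :=
  GRing.isLinear.Build K L L *:%R gr_partial_comb gr_partial_comb_is_linear.

Lemma gr_partial_comb_gen j : gr_partial_comb (gr_gen j) = u j.
Proof.
rewrite /gr_partial_comb (bigD1 j) //= big1 => [|i /negPf nij].
  by rewrite gr_partial_gen eqxx mulr1 addr0.
by rewrite gr_partial_gen nij mulr0.
Qed.

(** Even coefficients are central, so they pass the left factor in the second Leibniz term. *)
Lemma gr_partial_comb_skew : (forall i, u i \in gr_parity false) ->
  skew_derivation (gr_partial_comb : {linear L -> L}).
Proof.
move=> uP s t a b aP bP /=; rewrite /gr_partial_comb mulr_suml mulr_sumr.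
rewrite -big_split; apply: eq_bigr => i _ /=.
rewrite (gr_partial_skew i aP bP) /= mulrDr !mulrA; congr (_ + _ * _).
by rewrite -[u i * _ * a]mulrA (gr_even_comm _ (uP i)).
Qed.

End Combination.

(** * Compatibility relations and the coordinates of the formula *)

(** Apply [d] to x_i x_j + x_j x_i = 0, valid also for i = j. The odd values of [d] anticommute with
    generators, so the relation appears doubled and [half] removes the factor 2. *)
Lemma even_skew_gen (half : K) (d : {linear L -> L}) i j :
    2%:R * half = 1 -> skew_derivation d -> preserves_parity d ->
  gr_gen j * d (gr_gen i) = - (gr_gen i * d (gr_gen j)).
Proof.
move=> half2 dS dP; have gP := @gr_gen_parity K n.
have gg : gr_gen i * gr_gen j + gr_gen j * gr_gen i = 0 :> L.
  have [->|/(gr_gen_anti K) ->] := eqVneq i j; last by rewrite addNr.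
  by rewrite gr_gen_sqr addr0.
have dg k l : d (gr_gen k) * gr_gen l = - (gr_gen l * d (gr_gen k)).
  by rewrite (gr_supercomm (dP _ _ (gP k)) (gP l)) expr1 mulN1r.
move/(congr1 d): gg; rewrite linear0 linearD /= (dS _ _ _ _ (gP i) (gP j)).
rewrite (dS _ _ _ _ (gP j) (gP i)) !expr1 !mulN1r !mulNr !dg.
rewrite -!opprD [gr_gen i * _ + _]addrC -mulr2n => /eqP.
rewrite oppr_eq0 => /eqP xx.
apply/eqP; rewrite -addr_eq0.
apply/eqP; rewrite -[LHS]scale1r -half2 mulrC -scalerA scaler_nat.
by rewrite xx scaler0.
Qed.

(** The separate term is the case i = 0 of the sum, where the condition on smaller indices is
    vacuous; the other terms are evaluated by [gr_prod_partials]. *)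
Lemma gr_formulaE (n_gt0 : (0 < n)%N) (w : 'I_n -> L) S :
  (\sum_(i < n | (0 < i)%N) (\prod_(j < n | (j < i)%N) gr_gen j) *
       gr_partials [seq j : 'I_n <- enum 'I_n | (j < i)%N] (w i)
     + w (Ordinal n_gt0)) S
  = \sum_(i < n | [forall (j : 'I_n | (j < i)%N), j \in S]) w i S.
Proof.
rewrite gr_addE gr_sumE [RHS](bigD1 (Ordinal n_gt0)) /=; last first.
  by apply/forall_inP.
rewrite addrC; congr (_ + _).
rewrite big_mkcond [RHS]big_mkcond; apply: eq_bigr => i _.
rewrite lt0n -val_eqE /= andbC; case: eqP => //= _.
rewrite -big_filter [index_enum _]unlock -enumT.
rewrite gr_prod_partials ?filter_uniq -?enumT ?enum_uniq //.
congr (if _ then _ else _); apply/allP/forall_inP => jS j.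
  by move=> ji; apply: jS; rewrite mem_filter ji mem_enum.
by rewrite mem_filter => /andP[/jS].
Qed.

(** For odd [n] the top monomial has odd degree, so evenness already excludes it. *)
Lemma gr_ev'_coordT a : a \in gr_ev' -> a setT = 0.
Proof.
case/andP=> /gr_parityP aP /orP[on|/eqP//].
by apply: aP; rewrite cardsT card_ord on.
Qed.

End Grassmann.

Theorem corollary3p2 (K : comPzRingType) (half : K) (half2 : 2%:R * half = 1)
    (n : nat) (n_gt0 : (0 < n)%N)
    (delta : {linear grassmann K n -> grassmann K n})
    (delta_skew : skew_derivation delta)
    (u_ev u_od : 'I_n -> grassmann K n)
    (u_evP : forall i, u_ev i \in gr_parity false)
    (u_odP : forall i, u_od i \in gr_parity true)
    (delta_gen : forall i, delta (gr_gen i) = u_ev i + u_od i)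
    (delta_ev delta_od : {linear grassmann K n -> grassmann K n})
    (delta_ev_skew : skew_derivation delta_ev)
    (delta_od_skew : skew_derivation delta_od)
    (delta_evP : preserves_parity delta_ev)
    (delta_odP : reverses_parity delta_od)
    (delta_dec : forall b : grassmann K n, delta b = delta_ev b + delta_od b) :
  (forall b : grassmann K n, delta_od b = \sum_(i < n) u_ev i * gr_partial i b) /\
  unique (fun a => a \in gr_ev' /\ forall b : grassmann K n, delta_ev b = half *: sad a b)
    (\sum_(i < n | (0 < i)%N)
        (\prod_(j < n | (j < i)%N) gr_gen j) *
        gr_partials [seq j : 'I_n <- enum 'I_n | (j < i)%N]
          (gr_partial i (u_od i))
     + gr_partial (Ordinal n_gt0) (u_od (Ordinal n_gt0))).
Proof.
have gP := @gr_gen_parity K n.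
have [dev dod] := skew_decomposition_unique delta_evP delta_odP delta_dec.
have odg i : delta_od (gr_gen i) = u_ev i.
  rewrite dod (gr_componentE _ _ (gP i)) delta_gen linearD /=.
  by rewrite (gr_proj_id (u_evP i)) (gr_proj_eq0 (u_odP i)) ?addr0.
have evg i : delta_ev (gr_gen i) = u_od i.
  rewrite dev (gr_componentE _ _ (gP i)) delta_gen linearD /=.
  by rewrite (gr_proj_id (u_odP i)) (gr_proj_eq0 (u_evP i)) ?add0r.
split=> [b|].
  rewrite -/(gr_partial_comb u_ev b).
  apply: (skew_ext delta_od_skew (gr_partial_comb_skew u_evP)) => i /=.
  by rewrite odg gr_partial_comb_gen.
have xuC i j : gr_gen j * u_od i = - (gr_gen i * u_od j).
  by rewrite -!evg; apply: even_skew_gen half2 delta_ev_skew delta_evP.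
(* The case i = j of [xuC] makes this product its own negative, and 2 is invertible. *)
have xu0 i : gr_gen i * u_od i = 0.
  rewrite -evg -[LHS]scale1r -half2 mulrC -scalerA scaler_nat mulr2n evg.
  by rewrite {1}xuC addNr scaler0.
pose w i := gr_partial i (u_od i).
have uE i : u_od i = gr_gen i * w i by apply: gr_gen_partial (u_odP i) (xu0 i).
(* From x_j x_i w_i = x_j u_i = - x_i u_j = x_j x_i w_j, cancel x_j at [i |: S], then x_i at [S]. *)
have wC i j (S : {set _}) : i \notin S -> j \notin S -> w i S = w j S.
  have [-> //|nij] := eqVneq i j => iS jS.
  have jiS : j \notin i |: S by rewrite !inE negb_or eq_sym nij.
  have xxE : gr_gen j * (gr_gen i * w i) = gr_gen j * (gr_gen i * w j).
    by rewrite -uE xuC uE !mulrA (gr_gen_anti K nij) mulNr opprK.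
  have := gr_genM_coordI jiS xxE; rewrite !gr_genMU //.
  by move/(congr1 ( *%R ((-1) ^+ gr_inv [set i] S))); rewrite !signrMK.
have w0 i (S : {set _}) : i \in S -> w i S = 0 by rewrite /w gr_partialE => ->.
set a := (X in unique _ X).
have aE i (S : {set _}) : i \notin S -> a S = w i S.
  move=> iS; rewrite /a (gr_formulaE n_gt0 w).
  (* Only the smallest index [m] outside [S] contributes: a larger index fails the summation
     condition at [m], and a smaller one lies in [S], where its [w] vanishes. *)
  case: (@arg_minnP _ i [pred k | k \notin S] val iS) => /= m mS m_min.
  rewrite (bigD1 m) /=; last first.
    apply/forall_inP => j; apply: contraTT => /m_min.
    by rewrite -leqNgt.
  rewrite big1 ?addr0; first exact: wC.
  move=> k /andP[/forall_inP kS nkm]; apply: w0.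
  apply: contraT => kNS; have := m_min k kNS.
  rewrite leq_eqVlt eq_sym val_eqE (negPf nkm) /= => /kS.
  by rewrite (negPf mS).
have aT : a setT = 0.
  by rewrite /a (gr_formulaE n_gt0 w) big1 // => i _; apply: w0; rewrite inE.
have aP : a \in gr_parity false.
  apply/gr_parityP => S oS; have [->//|] := eqVneq S setT.
  rewrite -subTset => /subsetPn[i _ iS]; rewrite (aE i) //.
  by have /gr_parityP/(_ S oS) := gr_partial_parity i (u_odP i).
have xa i : gr_gen i * a = u_od i.
  apply/ffunP=> S; rewrite uE !gr_genM; case: ifP => // iS.
  by rewrite (aE i) // setD11.
split.
  split=> [|b]; first by apply/andP; rewrite aP aT eqxx orbT.
  (* With the scalar moved inside, the right side is itself of the form sad(c), so [sad_skew]
     applies. *)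
  rewrite -sadZ.
  apply: (skew_ext delta_ev_skew (sad_skew (half *: a))) => i /=.
  by rewrite sadZ half_sad_gen // xa evg.
(* Uniqueness: the top coordinate vanishes for both elements. Any other [S] misses some i, and x_i
   a' = u_i^od = x_i a determines the coordinate there. *)
move=> a' [a'P a'E]; have [a'ev _] := andP a'P.
apply/ffunP=> S; have [->|] := eqVneq S setT.
  by rewrite aT gr_ev'_coordT.
rewrite -subTset => /subsetPn[i _ iS]; apply: (gr_genM_coordI iS).
by rewrite xa -evg a'E half_sad_gen.
Qed.
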